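(* Let $(V_1,\nu_1,\tau,\tau^* )$ and $(V_2,\nu_2,\tau,\tau^* )$ be two PN spaces under the same triangle functions $\tau$ and $\tau^*$, and let the triangle function $\tau_1$ be such that $\tau^*\gg\tau_1$ and $\tau_1\gg\tau$. Let $(V_1,\mathcal F_1,\tau)$ and $(V_2,\mathcal F_2,\tau)$ be the same spaces regarded as PM spaces. Then the $\tau_1$-product $(V_1\times V_2,\nu^{\tau_1},\tau,\tau^* )$, regarded as a PM space, coincides with the $\tau_1$-product $(V_1\times V_2,\mathcal F^{\tau_1})$ of the PM spaces $(V_1,\mathcal F_1,\tau)$ and $(V_2,\mathcal F_2,\tau)$.
   Context: $\Delta^+$ is the set of distance distribution functions: nondecreasing $F:[0,+\infty]\to[0,1]$ with $F(0)=0$, $F(+\infty)=1$, left-continuous on $(0,+\infty)$; it is ordered pointwise and endowed with the topology of weak convergence. $\epsilon_0(x)=0$ for $x\le 0$ and $\epsilon_0(x)=1$ for $x>0$. A triangle function is a binary operation on $\Delta^+$ that is commutative, associative, nondecreasing in each argument and has $\epsilon_0$ as identity; continuity refers to the topology of weak convergence. A PN space is a quadruple $(V,\nu,\tau,\tau^* )$ where $V$ is a real linear space with null vector $\theta$, $\tau,\tau^*$ are continuous triangle functions with $\tau\le\tau^*$, and $\nu:V\to\Delta^+$, $p\mapsto\nu_p=\nu(p)$, satisfies: (N1) $\nu_p=\epsilon_0$ iff $p=\theta$; (N2) $\nu_{-p}=\nu_p$; (N3) $\nu_{p+q}\ge\tau(\nu_p,\nu_q)$; (N4) $\nu_p\le\tau^*(\nu_{\alpha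 p},\nu_{(1-\alpha)p})$ for all $\alpha\in[0,1]$; for all $p,q\in V$. A PM (probabilistic metric) space is a triple $(S,\mathcal F,\tau)$ with $S$ a nonempty set, $\tau$ a triangle function and $\mathcal F:S\times S\to\Delta^+$ such that for all $p,q,r\in S$: $\mathcal F(p,p)=\epsilon_0$; $\mathcal F(p,q)\ne\epsilon_0$ if $p\ne q$; $\mathcal F(p,q)=\mathcal F(q,p)$; $\mathcal F(p,r)\ge\tau(\mathcal F(p,q),\mathcal F(q,r))$. A PN space $(V,\nu,\tau,\tau^* )$ is regarded as a PM space $(V,\mathcal F,\tau)$ by setting $\mathcal F(p,q):=\nu_{p-q}$. The $\tau_1$-product of the PN spaces is $(V_1\times V_2,\nu^{\tau_1},\tau,\tau^* )$ with $\nu^{\tau_1}(p,q):=\tau_1(\nu_1(p),\nu_2(q))$. The $\tau_1$-product of the PM spaces is $(V_1\times V_2,\mathcal F^{\tau_1})$ with $\mathcal F^{\tau_1}((p_1,p_2),(q_1,q_2)):=\tau_1(\mathcal F_1(p_1,q_1),\mathcal F_2(p_2,q_2))$. For triangle functions, $\sigma_1\gg\sigma_2$ (dominates) means that for all $F_1,F_2,G_1,G_2\in\Delta^+$: $\sigma_1(\sigma_2(F_1,G_1),\sigma_2(F_2,G_2))\ge\sigma_2(\sigma_1(F_1,F_2),\sigma_1(G_1,G_2))$. *)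

(* Defs.v *)
From HB Require Import structures.
From mathcomp Require Import all_boot all_order all_algebra.
From mathcomp Require Import all_classical all_reals all_analysis.
From mathcomp Require Import lra.
Set Implicit Arguments.
Unset Strict Implicit.
Unset Printing Implicit Defensive.
Import Order.TTheory GRing.Theory Num.Theory.
Import numFieldNormedType.Exports.
Local Open Scope classical_set_scope.
Local Open Scope ring_scope.

(* A distance distribution function on [0, +oo] is encoded as a function on
   \bar R that vanishes on [-oo, 0], the convention under which epsilon_0 is
   usually written.  The extension is unique, so equality and order on \bar R
   are equality and order on [0, +oo]. *)
Record ddf (R : realType) := DDF {
  ddf_fun :> \bar R -> R ;
  ddf_itv : forall x, 0 <= ddf_fun x <= 1 ;
  ddf_nd : {homo ddf_fun : x y / (x <= y)%E >-> x <= y} ;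
  ddf_npos : forall x, (x <= 0)%E -> ddf_fun x = 0 ;
  ddf_pinfty : ddf_fun +oo%E = 1 ;
  ddf_left_cts : forall x : R, 0 < x ->
    ddf_fun y%:E @[y --> x^'-] --> ddf_fun x%:E
}.

Definition ddf_le (R : realType) (F G : ddf R) : Prop := forall x, F x <= G x.

Section eps0.
Context {R : realType}.

Definition eps0_fun (x : \bar R) : R := if (x <= 0)%E then 0 else 1.

Let eps0_itv x : 0 <= eps0_fun x <= 1.
Proof. by rewrite /eps0_fun; case: ifP; rewrite ?lexx ler01. Qed.

Let eps0_nd : {homo eps0_fun : x y / (x <= y)%E >-> x <= y}.
Proof.
move=> x y xy; rewrite /eps0_fun; case: (leP y 0%E) => [y0|y0].
  by rewrite (le_trans xy y0).
by case: ifP.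
Qed.

Let eps0_npos x : (x <= 0)%E -> eps0_fun x = 0.
Proof. by rewrite /eps0_fun => ->. Qed.

Let eps0_pinfty : eps0_fun +oo%E = 1.
Proof. by rewrite /eps0_fun. Qed.

Let eps0_left_cts (x : R) : 0 < x ->
  eps0_fun y%:E @[y --> x^'-] --> eps0_fun x%:E.
Proof.
move=> x0; apply: cvg_near_cst; near=> y.
have y0 : 0 < y by near: y; exact: nbhs_left_gt.
by rewrite /eps0_fun !lee_fin !leNgt x0 y0.
Unshelve. all: by end_near. Qed.

Definition eps0 : ddf R :=
  DDF eps0_itv eps0_nd eps0_npos eps0_pinfty eps0_left_cts.

End eps0.

Section weak_topology.
Context {R : realType}.
Implicit Types (F G H : ddf R) (x y : R).

HB.instance Definition _ := gen_eqMixin (ddf R).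
HB.instance Definition _ := gen_choiceMixin (ddf R).

Definition ddf_continuity_pt F x := {for x, continuous (fun y : R => F y%:E)}.

(* Only finite points matter: all elements agree at +oo and on [-oo, 0]. *)
Definition weak_ball F (s : seq R) (e : R) : set (ddf R) :=
  [set G | forall x, x \in s -> `|F x%:E - G x%:E| < e].

Definition weak_nbhs F : set_system (ddf R) :=
  [set U | exists s e, [/\ 0 < e,
     forall x, x \in s -> ddf_continuity_pt F x & weak_ball F s e `<=` U]].

HB.instance Definition _ := hasNbhs.Build (ddf R) weak_nbhs.

Let weak_nbhs_filter F : ProperFilter (weak_nbhs F).
Proof.
apply: Build_ProperFilter_ex.
  move=> U [s [e [e0 _ sU]]]; exists F; apply: sU => x _.
  by rewrite subrr normr0.
split.
- by exists [::], 1; split.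
- move=> U V [s [e [e0 Fs sU]]] [t [d [d0 Ft tV]]].
  exists (s ++ t), (Num.min e d); split.
  + by rewrite lt_min e0 d0.
  + by move=> x; rewrite mem_cat => /orP[/Fs|/Ft].
  + move=> G GF; split; [apply: sU|apply: tV] => x xs.
      by have := GF x; rewrite mem_cat xs lt_min => /(_ isT)/andP[].
    by have := GF x; rewrite mem_cat xs orbT lt_min => /(_ isT)/andP[].
- move=> U V UV [s [e [e0 Fs sU]]]; exists s, e; split=> //.
  exact: subset_trans UV.
Qed.

Let weak_nbhs_singleton F (U : set (ddf R)) : weak_nbhs F U -> U F.
Proof.
by move=> [s [e [e0 _ sU]]]; apply: sU => x _; rewrite subrr normr0.
Qed.

Lemma ddf_nd_fin F x y : x <= y -> F x%:E <= F y%:E.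
Proof. by move=> xy; apply: ddf_nd; rewrite lee_fin. Qed.

Lemma exists_ddf_continuity_pt F a b : a < b ->
  exists2 x, a < x < b & ddf_continuity_pt F x.
Proof.
move=> ab; pose f y := F y%:E.
have fl x : f y @[y --> x^'-] --> f x.
  have [x0|x0] := leP x 0; last exact: ddf_left_cts.
  apply: cvg_near_cst; near=> y; rewrite /f !ddf_npos ?lee_fin//.
  by apply: le_trans x0; near: y; exact: nbhs_left_le.
have fr x : cvg (f y @[y --> x^'+]).
  apply: nondecreasing_at_right_is_cvgr; near=> z.
    by move=> u v _ _; exact: ddf_nd_fin.
  by exists 0 => _ [y _ <-]; have /andP[] := ddf_itv F y%:E.
apply: contrapT => nc.
have := @discontinuity_countable R a b f (fun x y _ _ => @ddf_nd_fin F x y).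
move=> /countable_lebesgue_measure0 mu0.
have : lebesgue_measure (`]a, b[%classic : set R) = 0%E.
  rewrite -[RHS]mu0; congr (lebesgue_measure _); apply/seteqP; split=> x /=.
    move=> xab; split; first by [].
    split; [by apply/cvg_ex; exists (f x)|exact: fr|].
    apply/eqP => lrE; apply: nc; exists x; first by move: xab; rewrite in_itv.
    apply/left_right_continuousP; split; first exact: fl.
    have /cvg_lim lE := fl x; rewrite -[F _](lE _)// lrE; exact: fr.
  by case.
rewrite lebesgue_measure_itv/= lte_fin ab -EFinD => -[] /eqP.
by rewrite subr_eq0 => /eqP ba; rewrite ba ltxx in ab.
Unshelve. all: by end_near. Qed.

Let weak_nbhs_pt F x (e : R) : ddf_continuity_pt F x -> 0 < e ->
  weak_nbhs F
    [set G | weak_nbhs G [set H | `|F x%:E - H x%:E| < e]].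
Proof.
move=> Fx e0; have e40 : 0 < e / 4 by rewrite divr_gt0.
have /cvgrPdist_lt/(_ _ e40)/nbhs_ballP[d /= d0 dF] := Fx.
have [a axd aF] := @exists_ddf_continuity_pt F (x - d) x ltac:(lra).
have [b bxd bF] := @exists_ddf_continuity_pt F x (x + d) ltac:(lra).
have Fa : `|F x%:E - F a%:E| < e / 4.
  by apply: dF; rewrite /ball/= ltr_norml; lra.
have Fb : `|F x%:E - F b%:E| < e / 4.
  by apply: dF; rewrite /ball/= ltr_norml; lra.
exists [:: a; b], (e / 4); split => //.
  by move=> y; rewrite !inE => /orP[] /eqP ->.
move=> G GF /=.
have Ga := GF a (mem_head _ _).
have Gb : `|F b%:E - G b%:E| < e / 4 by apply: GF; rewrite !inE eqxx orbT.
have [c ac cG] := @exists_ddf_continuity_pt G a x ltac:(lra).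
have [g gb gG] := @exists_ddf_continuity_pt G x b ltac:(lra).
exists [:: c; g], (e / 4); split => //.
  by move=> y; rewrite !inE => /orP[] /eqP ->.
move=> H HG /=.
have Hc := HG c (mem_head _ _).
have Hg : `|G g%:E - H g%:E| < e / 4 by apply: HG; rewrite !inE eqxx orbT.
have G1 := @ddf_nd_fin G a c ltac:(lra).
have G2 := @ddf_nd_fin G g b ltac:(lra).
have H1 := @ddf_nd_fin H c x ltac:(lra).
have H2 := @ddf_nd_fin H x g ltac:(lra).
move: Fa Fb Ga Gb Hc Hg; rewrite !ltr_norml; lra.
Qed.

Let weak_nbhs_nbhs F (U : set (ddf R)) :
  weak_nbhs F U -> weak_nbhs F (weak_nbhs^~ U).
Proof.
move=> [s [e [e0 Fs sU]]].
have wF G : Filter (weak_nbhs G) by have [] := weak_nbhs_filter G.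
suff: weak_nbhs F [set G | weak_nbhs G (weak_ball F s e)].
  by apply: filterS => G; exact: filterS.
elim: s Fs {sU} => [_|x s IH Fs].
  by apply: filterE => G; apply: filterE => H y.
have Fx := weak_nbhs_pt (Fs x (mem_head _ _)) e0.
have {IH}Fs' := IH (fun y ys => Fs y (mem_behead (s := x :: s) ys)).
apply: filterS2 Fx Fs' => G; apply: filterS2 => H Hx Hs y.
by rewrite inE => /predU1P[->|/Hs].
Qed.

HB.instance Definition _ := Nbhs_isNbhsTopological.Build (ddf R)
  weak_nbhs_filter weak_nbhs_singleton weak_nbhs_nbhs.

Lemma weak_cvgP {T : Type} (D : set_system T) {FD : Filter D}
    (u : T -> ddf R) F :
  u t @[t --> D] --> F <->
  forall x, ddf_continuity_pt F x -> u t x%:E @[t --> D] --> F x%:E.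
Proof.
split=> [uF x Fx|uF U [s [e [e0 Fs sU]]]].
  apply/cvgrPdist_lt => e e0.
  have : nbhs F [set G : ddf R | `|F x%:E - G x%:E| < e].
    exists [:: x], e; split => // [y|G GF]; first by rewrite inE => /eqP ->.
    exact/GF/mem_head.
  by move=> /uF.
suff : \forall t \near D, weak_ball F s e (u t) by apply: filterS => t /sU.
elim: s Fs {sU} => [_|x s IH Fs]; first by apply: filterE => t y.
have /cvgrPdist_lt/(_ _ e0) := uF x (Fs x (mem_head _ _)).
have := IH (fun y ys => Fs y (mem_behead (s := x :: s) ys)).
by apply: filterS2 => t ts tx y; rewrite inE => /predU1P[->|/ts].
Qed.

End weak_topology.

Section triangle_functions.
Context {R : realType}.
Implicit Types t s : ddf R -> ddf R -> ddf R.

Record is_triangle t : Prop := IsTriangle {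
  triangleC : commutative t ;
  triangleA : associative t ;
  triangle_ndl : forall F F' G, ddf_le F F' -> ddf_le (t F G) (t F' G) ;
  triangle_ndr : forall F G G', ddf_le G G' -> ddf_le (t F G) (t F G') ;
  triangle0t : left_id eps0 t ;
  trianglet0 : right_id eps0 t
}.

Definition triangle_continuous t : Prop :=
  continuous (fun FG : ddf R * ddf R => t FG.1 FG.2).

Definition triangle_le t s : Prop := forall F G, ddf_le (t F G) (s F G).

Definition dominates s1 s2 : Prop := forall F1 F2 G1 G2 : ddf R,
  ddf_le (s2 (s1 F1 F2) (s1 G1 G2)) (s1 (s2 F1 G1) (s2 F2 G2)).

End triangle_functions.

(* The tuples (V, nu, tau, tau^* ) and (S, F, tau); the functions tau, tau^*
   are parameters of the types, so that two spaces can be said to be under the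
   same ones.  The axioms are the predicates is_pn and is_pm. *)
Record pn_struct (R : realType) (tau taus : ddf R -> ddf R -> ddf R) :=
  PNStruct { pn_space : lmodType R ; pn_norm : pn_space -> ddf R }.

Record pm_struct (R : realType) (tau : ddf R -> ddf R -> ddf R) :=
  PMStruct { pm_space : Type ; pm_dist : pm_space -> pm_space -> ddf R }.

Section spaces.
Context {R : realType} {tau taus : ddf R -> ddf R -> ddf R}.

Record is_pn (P : pn_struct tau taus) : Prop := IsPN {
  pn_tau : is_triangle tau ;
  pn_taus : is_triangle taus ;
  pn_tau_cts : triangle_continuous tau ;
  pn_taus_cts : triangle_continuous taus ;
  pn_tau_le : triangle_le tau taus ;
  pn_N1 : forall p : pn_space P, pn_norm p = eps0 <-> p = 0 ;
  pn_N2 : forall p : pn_space P, pn_norm (- p) = pn_norm p ;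
  pn_N3 : forall p q : pn_space P,
    ddf_le (tau (pn_norm p) (pn_norm q)) (pn_norm (p + q)) ;
  pn_N4 : forall (p : pn_space P) (a : R), 0 <= a <= 1 ->
    ddf_le (pn_norm p) (taus (pn_norm (a *: p)) (pn_norm ((1 - a) *: p)))
}.

Record is_pm (M : pm_struct tau) : Prop := IsPM {
  pm_nonempty : inhabited (pm_space M) ;
  pm_tau : is_triangle tau ;
  pm_refl : forall p : pm_space M, pm_dist p p = eps0 ;
  pm_sep : forall p q : pm_space M, p <> q -> pm_dist p q <> eps0 ;
  pm_sym : forall p q : pm_space M, pm_dist p q = pm_dist q p ;
  pm_triangle : forall p q r : pm_space M,
    ddf_le (tau (pm_dist p q) (pm_dist q r)) (pm_dist p r)
}.

Definition pm_of_pn (P : pn_struct tau taus) : pm_struct tau :=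
  @PMStruct R tau (pn_space P) (fun p q => pn_norm (p - q)).

Definition pn_prod (tau1 : ddf R -> ddf R -> ddf R)
    (P1 P2 : pn_struct tau taus) : pn_struct tau taus :=
  @PNStruct R tau taus (pn_space P1 * pn_space P2)%type
    (fun p => tau1 (pn_norm p.1) (pn_norm p.2)).

Definition pm_prod (tau1 : ddf R -> ddf R -> ddf R)
    (M1 M2 : pm_struct tau) : pm_struct tau :=
  @PMStruct R tau (pm_space M1 * pm_space M2)%type
    (fun p q => tau1 (pm_dist p.1 q.1) (pm_dist p.2 q.2)).

End spaces.

(* Main.v *)
(* The two PM structures agree because subtraction on V1 * V2 is componentwise.
   The axioms (N3) and (N4) of the product follow from those of the factors by
   monotonicity of tau1 and the dominations tau1 >> tau and tau^* >> tau1.  For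
   (N1), eps0 is the greatest element of Delta^+ and tau1 F G <= F, G. *)
Require Import Defs.
From mathcomp Require Import all_boot all_order all_algebra.
From mathcomp Require Import all_classical all_reals all_analysis.

Import Order.TTheory GRing.Theory Num.Theory.
Local Open Scope ring_scope.

Lemma ddf_le_trans (R : realType) (G F H : ddf R) :
  ddf_le F G -> ddf_le G H -> ddf_le F H.
Proof. by move=> FG GH x; exact: le_trans (FG x) (GH x). Qed.

Lemma ddf_le_anti (R : realType) (F G : ddf R) :
  ddf_le F G -> ddf_le G F -> F = G.
Proof.
move=> FG GF.
have : ddf_fun F = ddf_fun G.
  by apply/funext => x; apply/le_anti; rewrite FG GF.
(* Apart from the underlying function, the fields of [ddf] are proofs, so proof irrelevance
   identifies the two records. *)
case: F {FG GF} => f f1 f2 f3 f4 f5; case: G => g g1 g2 g3 g4 g5 /= fg.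
by rewrite {}fg in f1 f2 f3 f4 f5 *; congr DDF; exact: Prop_irrelevance.
Qed.

(** [eps0] is 0 only on nonpositive arguments, where every [ddf] vanishes, and takes the maximal
    value 1 elsewhere. *)
Lemma ddf_le_eps0 (R : realType) (F : ddf R) : ddf_le F eps0.
Proof.
move=> x; rewrite /= /eps0_fun; case: ifP => [/(ddf_npos F) -> //|_].
by have /andP[] := ddf_itv F x.
Qed.

Section triangle.
Context {R : realType} {t : ddf R -> ddf R -> ddf R}.
Hypothesis ht : is_triangle t.

Lemma triangle_nd (F F' G G' : ddf R) :
  ddf_le F F' -> ddf_le G G' -> ddf_le (t F G) (t F' G').
Proof.
move=> FF' GG'; apply: (@ddf_le_trans _ (t F' G)).
  exact: (triangle_ndl ht _ FF').
exact: (triangle_ndr ht _ GG').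
Qed.

(** Raising [G] to the top element [eps0], which is the identity of [t], can only increase
    [t F G]. *)
Lemma triangle_le_l (F G : ddf R) : ddf_le (t F G) F.
Proof.
have := triangle_ndr ht F (@ddf_le_eps0 _ G).
by rewrite (trianglet0 ht).
Qed.

Lemma triangle_eq_eps0 (F G : ddf R) :
  t F G = eps0 <-> F = eps0 /\ G = eps0.
Proof.
split=> [tE|[-> ->]]; last exact: (triangle0t ht).
have FE : F = eps0.
  by apply: ddf_le_anti (@ddf_le_eps0 _ F) _; rewrite -tE; exact: triangle_le_l.
(* With [F = eps0] known, the identity law turns [t F G] into [G]. *)
by split=> //; rewrite -tE FE (triangle0t ht).
Qed.

End triangle.

Section spaces.
Context {R : realType} {tau taus : ddf R -> ddf R -> ddf R}.

Lemma is_pm_of_pn (P : pn_struct tau taus) : is_pn P -> is_pm (pm_of_pn P).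
Proof.
move=> hP; split=> /=.
- exact: (inhabits (0 : pn_space P)).
- exact: (pn_tau hP).
- by move=> p; rewrite subrr; apply/(pn_N1 hP).
- by move=> p q pq /(pn_N1 hP)/subr0_eq.
- by move=> p q; rewrite -(pn_N2 hP) opprB.
(* Telescoping: [p - r = (p - q) + (q - r)]. *)
- by move=> p q r; rewrite -(subrKA q p (- r)); exact: (pn_N3 hP).
Qed.

Lemma is_pn_prod (tau1 : ddf R -> ddf R -> ddf R) (P1 P2 : pn_struct tau taus) :
  is_pn P1 -> is_pn P2 -> is_triangle tau1 ->
  dominates taus tau1 -> dominates tau1 tau -> is_pn (pn_prod tau1 P1 P2).
Proof.
move=> hP1 hP2 htau1 taus_tau1 tau1_tau; split=> /=.
- exact: (pn_tau hP1).
- exact: (pn_taus hP1).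
- exact: (pn_tau_cts hP1).
- exact: (pn_taus_cts hP1).
- exact: (pn_tau_le hP1).
- move=> [p1 p2]; split=> /=.
    by move=> /(triangle_eq_eps0 htau1)[/(pn_N1 hP1) -> /(pn_N1 hP2) ->].
  by case=> /(pn_N1 hP1) p1E /(pn_N1 hP2) p2E; apply/triangle_eq_eps0.
- by move=> [p1 p2] /=; rewrite (pn_N2 hP1) (pn_N2 hP2).
(* Domination regroups the four norms by factor, so that (N3) applies in each coordinate. *)
- move=> [p1 p2] [q1 q2]; apply: ddf_le_trans (tau1_tau _ _ _ _) _.
  by apply: (triangle_nd htau1); [exact: (pn_N3 hP1)|exact: (pn_N3 hP2)].
(* Here the regrouping is on the upper side: (N4) bounds each coordinate first, and domination then
   exchanges [tau1] and [taus]. *)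
- move=> [p1 p2] a a01; apply: ddf_le_trans _ (taus_tau1 _ _ _ _).
  by apply: (triangle_nd htau1); [exact: (pn_N4 hP1)|exact: (pn_N4 hP2)].
Qed.

End spaces.

Theorem theorem3 (R : realType) (tau taus tau1 : ddf R -> ddf R -> ddf R)
    (P1 P2 : pn_struct tau taus)
    (hP1 : is_pn P1) (hP2 : is_pn P2)
    (htau1 : is_triangle tau1)
    (htaus_tau1 : dominates taus tau1) (htau1_tau : dominates tau1 tau) :
  [/\ is_pn (pn_prod tau1 P1 P2),
      is_pm (pm_of_pn (pn_prod tau1 P1 P2)) &
      pm_of_pn (pn_prod tau1 P1 P2) =
        pm_prod tau1 (pm_of_pn P1) (pm_of_pn P2)].
Proof.
have hP : is_pn (pn_prod tau1 P1 P2) by exact: is_pn_prod.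
(* The equality of PM structures holds by computation, since the projections of a difference of
   pairs reduce. *)
by split=> //; exact: is_pm_of_pn.
Qed.
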